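(* Let $G$ be a connected graph on $n\ge 3$ vertices with degrees $d_1,\ldots,d_n$ and average degree $\Delta=\frac{1}{n}\sum_i d_i$, and let $\lambda_1\ge\cdots\ge\lambda_{n-1}\ge\lambda_n=0$ be the eigenvalues of its Laplacian matrix. Writing $Q=\sum_i d_i^2+n\Delta-\frac{n^2\Delta^2}{n-1}$, $$\frac{n}{n-1}\Delta-\sqrt{\frac{n-2}{n-1}\,Q}\le\lambda_{n-1}\le\frac{n}{n-1}\Delta-\sqrt{\frac{Q}{(n-1)(n-2)}}$$ and $$\frac{n}{n-1}\Delta+\sqrt{\frac{Q}{(n-1)(n-2)}}\le\lambda_1\le\frac{n}{n-1}\Delta+\sqrt{\frac{n-2}{n-1}\,Q}.$$
   Context: Graphs are simple, finite and undirected. The Laplacian matrix is $L=D-A$, where $A$ is the adjacency matrix and $D$ the diagonal matrix of vertex degrees. *)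

(* Defs.v *)
From mathcomp Require Import all_boot all_order all_algebra.
From mathcomp Require Import complex.

Set Implicit Arguments.
Unset Strict Implicit.
Unset Printing Implicit Defensive.

Import Order.TTheory GRing.Theory Num.Theory.
Local Open Scope ring_scope.

Section Graph.
Variables (n : nat) (e : rel 'I_n).

Definition simple_graph : Prop := symmetric e /\ irreflexive e.

Definition connected_graph : Prop := forall u v : 'I_n, connect e u v.

Definition degree (i : 'I_n) : nat := #|[set j | e i j]|.

Variable R : rcfType.

Definition avg_degree : R := (\sum_i (degree i)%:R) / n%:R.

Definition adjacency_mx : 'M[R]_n := \matrix_(i, j) (e i j)%:R.

Definition degree_mx : 'M[R]_n := diag_mx (\row_i (degree i)%:R).

Definition laplacian_mx : 'M[R]_n := degree_mx - adjacency_mx.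

Definition Qparam : R :=
  \sum_i (degree i)%:R ^+ 2 + n%:R * avg_degree
  - n%:R ^+ 2 * avg_degree ^+ 2 / (n%:R - 1).

End Graph.

(* lam lists all the eigenvalues of A, with algebraic multiplicity (so its    *)
(* size is necessarily n), in non-increasing order: the k-th largest one is   *)
(* lam`_(k.-1), indices starting from 0.                                      *)
Definition ordered_spectrum (R : rcfType) (n : nat) (A : 'M[R]_n)
    (lam : seq R) : Prop :=
  sorted >=%R lam /\ char_poly A = \prod_(x <- lam) ('X - x%:P).

Lemma ordered_spectrum_unique (R : rcfType) n (A : 'M[R]_n) (s t : seq R) :
  ordered_spectrum A s -> ordered_spectrum A t -> s = t.
Proof.
move=> [ss es] [st et].
have hp : perm_eq s t by apply: prod_XsubC_eq; rewrite -es -et.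
apply: (sorted_eq ge_trans _ ss st hp).
by move=> x y h; apply: le_anti; rewrite andbC.
Qed.

Lemma ordered_spectrum_exists (R : rcfType) n (A : 'M[R]_n) :
  A^T = A -> exists lam, ordered_spectrum A lam.
Proof.
move=> symA.
suff [s es] : exists s : seq R, char_poly A = \prod_(x <- s) ('X - x%:P).
  exists (sort >=%R s); split; first exact/sort_sorted/ge_total.
  by rewrite es; apply/perm_big; rewrite perm_sym perm_sort.
pose B : 'M[R[i]]_n := map_mx (real_complex R) A.
have hB : B \is hermsymmx.
  apply: realsym_hermsym.
    apply/is_hermitianmxP; rewrite expr0 scale1r map_mx_id //.
    by rewrite /B map_trmx symA.
  by apply/mxOverP => i j; rewrite mxE complex_real.
have /orthomx_spectralP eB := hermitian_normalmx hB.
have /mxOverP hr := hermitian_spectral_diag_real hB.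
exists [seq complex.Re (spectral_diag B 0 i) | i : 'I_n].
apply: (map_poly_inj (real_complex R)).
rewrite map_char_poly -/B {1}eB.
set P := spectralmx B; set D := diag_mx _.
have uP : P \in unitmx by apply/unitarymx_unit/spectral_unitarymx.
have -> : char_poly (invmx P *m D *m P) = char_poly D.
  rewrite /char_poly /char_poly_mx !map_mxM /=.
  set PX := map_mx polyC P; set VX := map_mx polyC (invmx P).
  have VP : VX *m PX = 1%:M by rewrite -map_mxM mulVmx // map_mx1.
  have XE : 'X%:M = VX *m 'X%:M *m PX.
    by rewrite scalar_mxC -mulmxA VP mulmx1.
  by rewrite {1}XE -mulmxBl -mulmxBr !det_mulmx mulrAC -det_mulmx VP det1 mul1r.
rewrite char_poly_trig ?diag_mx_is_trig // rmorph_prod big_image /=.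
apply: eq_bigr => i _.
by rewrite map_polyXsubC /= RRe_real ?hr // mxE eqxx mulr1n.
Qed.

Lemma laplacian_mx_sym (R : rcfType) n (e : rel 'I_n) :
  simple_graph e -> (laplacian_mx e R)^T = laplacian_mx e R.
Proof.
move=> [se _]; rewrite /laplacian_mx raddfB /= tr_diag_mx; congr (_ - _).
by apply/matrixP => i j; rewrite !mxE se.
Qed.

(* Main.v *)
(* The traces of L and L^2 give the sum S and the sum of squares T of the m = n-1
   eigenvalues other than the smallest one, which is 0. Then Q = T - S^2/m is
   m times their variance and n Delta/(n-1) = S/m their mean, so the upper bound
   on the distance of an eigenvalue to the mean is Samuelson's inequality and
   the lower bound on the distance of the extreme ones is Brunk's. *)

Require Import Defs.
From mathcomp Require Import all_boot all_order all_algebra.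
From mathcomp Require Import ring lra.

Set Implicit Arguments.
Unset Strict Implicit.
Unset Printing Implicit Defensive.

Import Order.TTheory GRing.Theory Num.Theory.
Local Open Scope ring_scope.

(** * Characteristic polynomial of the square of a matrix *)

(** Composition with [q] is a ring morphism, so it commutes with the determinant. Used with [q]
    equal to ['X^2] and to [- 'X]. *)
Lemma char_poly_comp (R : comNzRingType) n (A : 'M[R]_n) (q : {poly R}) :
  char_poly A \Po q = \det (q%:M - map_mx polyC A).
Proof.
rewrite /char_poly -[LHS]/(comp_poly q _) -det_map_mx; congr (\det _).
apply/matrixP => i j; rewrite !mxE raddfB /= comp_polyC; congr (_ - _).
by case: (i == j); rewrite ?mulr1n ?mulr0n ?comp_polyX ?comp_poly0.
Qed.

(* Both sides agree after substituting X^2 for X, because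
   X^2 - A^2 = (X - A)(X + A). *)
Lemma char_poly_sqr (R : idomainType) n (A : 'M[R]_n) (s : seq R) :
  char_poly A = \prod_(x <- s) ('X - x%:P) ->
  char_poly (A *m A) = \prod_(x <- [seq x ^+ 2 | x <- s]) ('X - x%:P).
Proof.
move=> eA.
have sz : size s = n.
  by apply/succn_inj; rewrite -(size_char_poly A) eA size_prod_XsubC.
apply/eqP; rewrite -subr_eq0 -(@comp_poly_eq0 _ _ 'X^2) ?size_polyXn //.
rewrite comp_polyB subr_eq0; apply/eqP.
rewrite char_poly_comp map_mxM big_map /=.
set B := map_mx polyC A.
(* The factor ['X%:M + B] is written as [-1] times [(- 'X)%:M - B], so that its determinant is, up
   to the sign [(-1) ^+ n], the characteristic polynomial of [A] at [- 'X]. *)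
have -> : ('X^2)%:M - B *m B = ('X%:M - B) *m ((-1) *: ((- 'X)%:M - B)).
  rewrite scaleN1r opprB raddfN opprK mulmxBl !mulmxDr -scalar_mxM -expr2.
  by rewrite -scalar_mxC /= [B *m _ + _%:M]addrC opprD addrA addrAC addrK.
rewrite det_mulmx detZ -!char_poly_comp comp_polyXr eA -sz.
rewrite -![_ \Po _]/(comp_poly _ _) !rmorph_prod /=.
elim: (s) => [|x t IH]; first by rewrite !big_nil expr0 !mulr1.
rewrite !big_cons -IH /= !comp_polyB comp_polyX !comp_polyC comp_polyX.
rewrite polyC_exp exprS.
ring.
Qed.

(** * Inequalities between the sum and the sum of squares of a list *)

Lemma sum_sqr_le_sqr_sum (R : realDomainType) (s : seq R) :
  all (fun x => 0 <= x) s -> \sum_(x <- s) x ^+ 2 <= (\sum_(x <- s) x) ^+ 2.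
Proof.
elim: s => [|x s IH] /=; first by rewrite !big_nil expr0n.
case/andP=> x0 hs; rewrite !big_cons.
have S0 : 0 <= \sum_(y <- s) y by rewrite big_seq sumr_ge0 // => y /(allP hs).
have := IH hs; have := mulr_ge0 x0 S0; lra.
Qed.

Lemma sqr_sum_le_size (R : realDomainType) (s : seq R) :
  (\sum_(x <- s) x) ^+ 2 <= (size s)%:R * \sum_(x <- s) x ^+ 2.
Proof.
elim: s => [|x s IH]; first by rewrite !big_nil mul0r expr0n.
(* Sum of [0 <= (x - y) ^+ 2] over [y] in [s]: it bounds the cross term created by adding [x] to the
   list. *)
have H : 2 * x * \sum_(y <- s) y <= (size s)%:R * x ^+ 2 + \sum_(y <- s) y ^+ 2.
  elim: s {IH} => [|y s IH]; first by rewrite !big_nil mulr0 mul0r add0r.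
  rewrite !big_cons /= -natr1; have := sqr_ge0 (x - y); nra.
rewrite !big_cons /= -natr1; nra.
Qed.

(** Remove [y] from the list: the difference of the two sides is [m] times the Cauchy-Schwarz defect
    of the other [m - 1] entries. *)
Lemma samuelson_ineq (R : realDomainType) (s : seq R) (y : R) :
  let m : R := (size s)%:R in
  let S := \sum_(x <- s) x in
  y \in s ->
  (m * y - S) ^+ 2 <= (m - 1) * (m * \sum_(x <- s) x ^+ 2 - S ^+ 2).
Proof.
move=> m S ys; rewrite /S /m.
have p := perm_to_rem ys; rewrite !(perm_big _ p) (perm_size p) /= !big_cons.
have := sqr_sum_le_size (rem y s); rewrite -natr1.
have : 0 <= (size (rem y s))%:R :> R by [].
move: (_%:R) (\sum_(_ <- _) _) (\sum_(_ <- _) _) => k S' T' k0 h; nra.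
Qed.

(* Sum of squares versus square of sum for the nonnegative numbers M - x. *)
Lemma brunk_max (R : realDomainType) (s : seq R) (M : R) :
  let m : R := (size s)%:R in
  let S := \sum_(x <- s) x in
  all (fun x => x <= M) s ->
  S <= m * M /\
  m * \sum_(x <- s) x ^+ 2 - S ^+ 2 <= (m - 1) * (m * M - S) ^+ 2.
Proof.
move=> m S hM.
have h0 : all (fun x => 0 <= x) [seq M - x | x <- s].
  by rewrite all_map; apply: sub_all hM => x /=; rewrite subr_ge0.
have := sum_sqr_le_sqr_sum h0.
have E1 : \sum_(x <- [seq M - x | x <- s]) x = m * M - S.
  rewrite big_map /m /S; elim: (s) => [|x t IH]; first by rewrite !big_nil /=; ring.
  rewrite !big_cons IH /= -natr1; ring.
have E2 : \sum_(x <- [seq M - x | x <- s]) x ^+ 2 =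
          m * M ^+ 2 - 2 * M * S + \sum_(x <- s) x ^+ 2.
  rewrite big_map /m /S; elim: (s) => [|x t IH]; first by rewrite !big_nil /=; ring.
  rewrite !big_cons IH /= -natr1; ring.
have S0 : 0 <= m * M - S.
  by rewrite -E1 big_seq sumr_ge0 // => y /(allP h0).
rewrite E1 E2 => h; split; first by rewrite -subr_ge0.
have : 0 <= m by [].
(* Multiply [h] by [m] and use [m * (m * M ^+ 2 - 2 * M * S + T) = (m * M - S) ^+ 2 + (m * T - S ^+
   2)]. *)
move: h; move: m S (\sum_(_ <- _) _) {E1 E2 S0} => m S T h m0; nra.
Qed.

Lemma brunk_min (R : realDomainType) (s : seq R) (M : R) :
  let m : R := (size s)%:R in
  let S := \sum_(x <- s) x in
  all (fun x => M <= x) s ->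
  m * M <= S /\
  m * \sum_(x <- s) x ^+ 2 - S ^+ 2 <= (m - 1) * (m * M - S) ^+ 2.
Proof.
move=> m S hM.
have : all (fun x => x <= - M) [seq - x | x <- s].
  by rewrite all_map; apply: sub_all hM => x /=; rewrite lerN2.
move/brunk_max; rewrite /= size_map !big_map sumrN mulrN lerN2 => -[-> h].
split=> //; move: h; under eq_bigr do rewrite sqrrN.
by rewrite sqrrN -opprD sqrrN.
Qed.

(** * Eigenvalues and traces of the Laplacian *)

Section Laplacian.
Variables (n : nat) (e : rel 'I_n) (R : rcfType).
Hypothesis hG : simple_graph e.
Let L := laplacian_mx e R.
Let d i : R := (degree e i)%:R.

Lemma sum_adj i : \sum_j (e i j)%:R = d i.
Proof.
rewrite /d /degree -sum1_card natr_sum [RHS]big_mkcond /=.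
by apply: eq_bigr => j _; rewrite inE; case: (e i j).
Qed.

Lemma laplacianE i j : L i j = d i *+ (i == j) - (e i j)%:R.
Proof. by rewrite !mxE. Qed.

(** In this form only differences of coordinates along edges occur: constant vectors are visibly in
    the kernel, and signs can be read off at an extremal coordinate. *)
Lemma laplacian_mulr (v : 'rV[R]_n) i :
  (v *m L) 0 i = \sum_j (e i j)%:R * (v 0 i - v 0 j).
Proof.
have [se _] := hG.
rewrite mxE; under eq_bigr do rewrite laplacianE mulrBr se.
rewrite sumrB (bigD1 i) //= eqxx mulr1n big1 ?addr0; last first.
  by move=> j /negbTE ->; rewrite mulr0n mulr0.
under [RHS]eq_bigr do rewrite mulrBr.
rewrite sumrB -mulr_suml sum_adj mulrC; congr (_ - _).
by apply: eq_bigr => j _; rewrite mulrC.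
Qed.

(* Evaluate v L = x v at a coordinate i where v_i^2 is maximal: there
   v_i (v_i - v_j) >= 0 for every j. *)
Lemma laplacian_eigenvalue_ge0 x : eigenvalue L x -> 0 <= x.
Proof.
case/eigenvalueP=> v ev /rV0Pn [k vk].
case: (arg_maxP (fun i => v 0 i ^+ 2) (erefl : xpredT k)) => i _ hi.
have vi : 0 < v 0 i ^+ 2.
  by apply: lt_le_trans (hi k isT); rewrite exprn_even_gt0.
rewrite -(pmulr_lge0 _ vi).
have /rowP/(_ i) := ev; rewrite laplacian_mulr mxE expr2 mulrA => <-.
rewrite mulr_suml sumr_ge0 // => j _; rewrite -mulrA mulr_ge0 //.
(* With a = [v 0 i] and b = [v 0 j], [2 * a * (a - b) = (a - b) ^+ 2 + (a ^+ 2 - b ^+ 2)]. *)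
have := hi j isT; have := sqr_ge0 (v 0 i - v 0 j); rewrite /=; nra.
Qed.

Lemma laplacian_eigenvalue0 : (0 < n)%N -> eigenvalue L 0.
Proof.
move=> n0; apply/eigenvalueP; exists (const_mx 1).
  apply/rowP => i; rewrite laplacian_mulr scale0r [RHS]mxE big1 // => j _.
  by rewrite !mxE subrr mulr0.
by apply/rV0Pn; exists (Ordinal n0); rewrite mxE oner_neq0.
Qed.

Lemma laplacian_trace : \tr L = \sum_i d i.
Proof.
have [_ ie] := hG.
by apply: eq_bigr => i _; rewrite laplacianE eqxx ie subr0.
Qed.

(** By symmetry the [i]-th diagonal entry of the square is the sum of the squares of row [i]:
    [d i ^+ 2] from the diagonal, and 1 for each neighbour. *)
Lemma laplacian_trace_sqr : \tr (L *m L) = \sum_i d i ^+ 2 + \sum_i d i.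
Proof.
have [se ie] := hG.
rewrite -big_split; apply: eq_bigr => i _ /=; rewrite mxE (bigD1 i) //=.
rewrite laplacianE eqxx ie subr0 -expr2; congr (_ + _).
rewrite -sum_adj [RHS](bigD1 i) //= ie add0r; apply: eq_bigr => j ij.
rewrite !laplacianE [i == j]eq_sym (negbTE ij) se !sub0r.
by rewrite mulrNN -natrM mulnb andbb.
Qed.

End Laplacian.

(** Both sides are minus the coefficient of degree [n.-1]. *)
Lemma sum_roots_char_poly (R : comNzRingType) n (A : 'M[R]_n) (s : seq R) :
  (0 < n)%N -> char_poly A = \prod_(x <- s) ('X - x%:P) ->
  \sum_(x <- s) x = \tr A.
Proof.
move=> n0 eA.
have sz : size s = n.
  by apply/succn_inj; rewrite -(size_char_poly A) eA size_prod_XsubC.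
apply: oppr_inj; rewrite -char_poly_trace // eA -coefPn_prod_XsubC sz //.
by rewrite -lt0n.
Qed.

(** Gathers all that the bounds need from the graph; from here on they concern only a sorted list
    with known first two power sums. *)
Lemma laplacian_spectrum (R : rcfType) n (e : rel 'I_n) (lam : seq R) :
  (0 < n)%N -> simple_graph e -> ordered_spectrum (laplacian_mx e R) lam ->
  exists s : seq R, [/\ lam = rcons s 0, (size s).+1 = n, sorted >=%R s,
    \sum_(x <- s) x = \sum_i (degree e i)%:R &
    \sum_(x <- s) x ^+ 2 = \sum_i (degree e i)%:R ^+ 2 + \sum_i (degree e i)%:R].
Proof.
move=> n0 hG [slam elam]; set L := laplacian_mx e R in elam.
have mem x : (x \in lam) = eigenvalue L x.
  by rewrite eigenvalue_root_char elam root_prod_XsubC.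
have sz : size lam = n.
  by apply/succn_inj; rewrite -(size_char_poly L) elam size_prod_XsubC.
have := sum_roots_char_poly n0 elam.
have := sum_roots_char_poly n0 (char_poly_sqr elam).
rewrite big_map laplacian_trace // laplacian_trace_sqr //.
have lam0 : 0 \in lam by rewrite mem laplacian_eigenvalue0.
have lamge x : x \in lam -> 0 <= x by rewrite mem => /(laplacian_eigenvalue_ge0 hG).
move: slam sz lam0 lamge; case/lastP: lam {elam mem} => [|s y] //.
rewrite size_rcons => ss sz lam0 lamge.
(* The last entry is nonnegative as an eigenvalue, and at most 0 because 0 occurs in a
   non-increasing list. *)
have {lam0} y0 : y = 0.
  apply/le_anti; rewrite (lamge y) ?mem_rcons ?mem_head // andbT.
  move: lam0; rewrite mem_rcons inE => /predU1P[-> //|s0].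
  move: ss; rewrite (sorted_pairwise ge_trans) pairwise_rcons.
  by case/andP=> /allP /(_ 0 s0).
rewrite -!cats1 !big_cat /= !big_seq1 {}y0 expr0n !addr0 => T S.
exists s; split=> //; first by rewrite cats1.
by move: ss; rewrite !(sorted_pairwise ge_trans) pairwise_rcons => /andP[].
Qed.

(** * Extreme entries of the list and the final bounds *)

Lemma sorted_ge_nth0 (R : realDomainType) (s : seq R) :
  sorted >=%R s -> all (fun x => x <= s`_0) s.
Proof.
case: s => //= x s; rewrite (path_sortedE ge_trans) lexx /=.
by case/andP.
Qed.

Lemma sorted_ge_nth_last (R : realDomainType) (s : seq R) :
  sorted >=%R s -> all (fun x => s`_(size s).-1 <= x) s.
Proof.
rewrite nth_last; case/lastP: s => // s x.
rewrite (sorted_pairwise ge_trans) pairwise_rcons last_rcons all_rcons lexx /=.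
by case/andP.
Qed.

Lemma sqrt_le_dist (R : rcfType) (a b q : R) :
  a <= b -> q <= (b - a) ^+ 2 -> Num.sqrt q <= b - a.
Proof.
by move=> ab /ler_wsqrtr; rewrite sqrtr_sqr ger0_norm ?subr_ge0.
Qed.

Theorem theorem5p2 (R : rcfType) (n : nat) (e : rel 'I_n) (lam : seq R)
    (hn : (3 <= n)%N) (hG : simple_graph e) (hc : connected_graph e)
    (hlam : ordered_spectrum (laplacian_mx e R) lam) :
  let N : R := n%:R in
  let Delta := avg_degree e R in
  let Q := Qparam e R in
  let lambda k := lam`_(k.-1) in
  (N / (N - 1) * Delta - Num.sqrt ((N - 2) / (N - 1) * Q) <= lambda n.-1
     <= N / (N - 1) * Delta - Num.sqrt (Q / ((N - 1) * (N - 2)))) /\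
  (N / (N - 1) * Delta + Num.sqrt (Q / ((N - 1) * (N - 2))) <= lambda 1%N
     <= N / (N - 1) * Delta + Num.sqrt ((N - 2) / (N - 1) * Q)).
Proof.
move=> N Delta Q lambda.
have [s [es sz ss eS eT]] := laplacian_spectrum (ltnW (ltnW hn)) hG hlam.
have s2 : (1 < size s)%N by rewrite -ltnS sz.
have mE : (size s)%:R = N - 1 by rewrite /N -sz -natr1 addrK.
set S := \sum_(x <- s) x in eS; set T := \sum_(x <- s) x ^+ 2 in eT.
have SE : N * Delta = S by rewrite /Delta /avg_degree -eS mulrC divfK // pnatr_eq0 -sz.
have QE : Q = T - S ^+ 2 / (N - 1).
  by rewrite /Q /Qparam -/N -/Delta -exprMn SE eT -eS.
have lE k : (k < size s)%N -> lam`_k = s`_k by move=> hk; rewrite es nth_rcons hk.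
have -> : lambda 1%N = s`_0 by rewrite /lambda lE // ltnW.
(* Counting from 0, this is index [n.-2] of [lam], just before the final 0: the last entry of
   [s]. *)
have -> : lambda n.-1 = s`_(size s).-1 by rewrite /lambda -sz lE // prednK // ltnW.
have /brunk_max := sorted_ge_nth0 ss; have /brunk_min := sorted_ge_nth_last ss.
have /samuelson_ineq : s`_0 \in s by rewrite mem_nth // ltnW.
have /samuelson_ineq : s`_(size s).-1 \in s by rewrite mem_nth // prednK // ltnW.
rewrite {ss}mE -/S -/T.
have aE : N / (N - 1) * Delta = S / (N - 1) by rewrite -SE mulrAC.
have N1 : 0 < N - 1 by rewrite subr_gt0 ltr1n ltnW.
have N2 : 0 < N - 2 by rewrite subr_gt0 (ltr_nat R 2).
rewrite aE; set a := S / (N - 1).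
have N1n : N - 1 != 0 by rewrite gt_eqF.
have devE y : (N - 1) * y - S = (N - 1) * (y - a).
  by rewrite mulrBr /a [_ * (S / _)]mulrC divfK.
have qE : (N - 1) * T - S ^+ 2 = (N - 1) * Q.
  by rewrite QE mulrBr [_ * (_ / _)]mulrC divfK.
(* Both this and [bru] divide out the length [N - 1] of [s], after centering at the mean [a]. *)
have sam y : ((N - 1) * y - S) ^+ 2 <= (N - 1 - 1) * ((N - 1) * T - S ^+ 2) ->
    `|y - a| <= Num.sqrt ((N - 2) / (N - 1) * Q).
  rewrite devE qE => h; rewrite -sqrtr_sqr ler_wsqrtr //.
  rewrite mulrAC ler_pdivlMr // -(ler_pM2l N1); nra.
have bru y : (N - 1) * T - S ^+ 2 <= (N - 1 - 1) * ((N - 1) * y - S) ^+ 2 ->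
    Q / ((N - 1) * (N - 2)) <= (y - a) ^+ 2.
  rewrite devE qE => h; rewrite ler_pdivrMr ?mulr_gt0 // -(ler_pM2l N1); nra.
move=> /sam + /sam + [le1 /bru h1] [le2 /bru h2].
rewrite !ler_distl => /andP[-> _] /andP[_ ->].
(* The two outer bounds are settled by [sam]. The inner ones become lower bounds on the distances
   from [a] to the extreme entries, with signs given by [le1] and [le2]. *)
rewrite andbT lerBrDr addrC -lerBrDr -[a + _ <= _]lerBrDl.
split; apply: sqrt_le_dist => //; last by rewrite ler_pdivrMr // mulrC.
  by rewrite ler_pdivlMr // mulrC.
by rewrite -sqrrN opprB.
Qed.
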